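(* Let $V$ be a reflexive Banach space, $X$ a Banach space, $\gamma\in\mathcal{L}(V,X)$ with $c_\gamma:=\|\gamma\|_{\mathcal{L}(V,X)}$ and adjoint $\gamma^*\colon X^*\to V^*$. Let $A\colon V\to V^*$, $J\colon X\times X\to\mathbb{R}$ and $f\in V^*$ satisfy: (A1) $A$ is linear and bounded; (A2) $\langle Au,v\rangle_{V^*\times V}=\langle Av,u\rangle_{V^*\times V}$ for all $u,v\in V$; (A3) there is $m_A>0$ with $\langle Au,u\rangle_{V^*\times V}\ge m_A\|u\|_V^2$ for all $u\in V$; (J1) $J$ is locally Lipschitz continuous with respect to its second variable; (J2) there exist $c_0,c_1,c_2\ge 0$ with $\|\partial_2 J(w,v)\|_{X^*}\le c_0+c_1\|v\|_X+c_2\|w\|_X$ for all $w,v\in X$; (J3) there exist $m_\alpha,m_L\ge0$ such that $J_2^0(w_1,v_1;v_2-v_1)+J_2^0(w_2,v_2;v_1-v_2)\le m_\alpha\|v_1-v_2\|_X^2+m_L\|w_1-w_2\|_X\|v_1-v_2\|_X$ for all $w_1,w_2,v_1,v_2\in X$; (S) $m_A>(m_\alpha+m_L)c_\gamma^2$. Let $\mathcal{L}(w,v)=\tfrac12\langle Av,v\rangle_{V^*\times V}-\langle f,v\rangle_{V^*\times V}+J(\gamma w,\gamma v)$ for $w,v\in V$. Consider Problem (I): find $u\in V$ with $Au+\gamma^*\partial_2J(\gamma u,\gamma u)\ni f$; and Problem (O): find $u\in V$ with $0\in\partial_2\mathcal{L}(u,u)$. Then Problems (I) and (O) are equivalent (have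 the same solutions), they have a unique solution $u\in V$, and this solution satisfies $\|u\|_V\le c\,(1+\|f\|_{V^*})$ with a positive constant $c$.
   Context: For a locally Lipschitz function $g$ on a Banach space $Y$, the generalized (Clarke) directional derivative at $x$ in direction $v$ is $g^0(x;v)=\limsup_{y\to x,\lambda\searrow0}\frac{g(y+\lambda v)-g(y)}{\lambda}$, and the Clarke subdifferential is $\partial g(x)=\{\xi\in Y^*:\langle\xi,v\rangle\le g^0(x;v)\ \forall v\in Y\}$. For a function of two variables, $\partial_2$ and $(\cdot)_2^0$ denote the Clarke subdifferential and generalized directional derivative with respect to the second variable. $\|\partial_2J(w,v)\|_{X^*}$ denotes $\sup\{\|\xi\|_{X^*}:\xi\in\partial_2J(w,v)\}$. *)

(* Defs.v *)
From HB Require Import structures.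
From mathcomp Require Import all_boot all_order all_algebra.
From mathcomp Require Import all_classical all_reals all_analysis.
Set Implicit Arguments. Unset Strict Implicit. Unset Printing Implicit Defensive.
Import Order.TTheory GRing.Theory Num.Theory.
Import numFieldNormedType.Exports.
Local Open Scope classical_set_scope.
Local Open Scope ring_scope.

Section Defs.
Variable R : realType.

Definition is_linear (V W : normedModType R) (T : V -> W) :=
  forall (a : R) (x y : V), T (a *: x + y) = a *: T x + T y.

Definition dual (V : normedModType R) : set (V -> R) :=
  [set xi | is_linear (xi : V -> R^o) /\ continuous xi].

Definition opnorm (V W : normedModType R) (T : V -> W) : R :=
  sup [set `|T v| | v in [set v : V | `|v| <= 1]].

Definition dual_norm (V : normedModType R) (xi : V -> R) : R :=
  opnorm (xi : V -> R^o).

Definition reflexive_space (V : normedModType R) : Prop :=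
  forall Phi : (V -> R) -> R,
    (forall (a : R) xi eta, @dual V xi -> @dual V eta ->
        Phi (fun v => a * xi v + eta v) = a * Phi xi + Phi eta) ->
    (exists C : R, forall xi, @dual V xi -> `|Phi xi| <= C * dual_norm xi) ->
    exists v : V, forall xi, @dual V xi -> Phi xi = xi v.

Definition locally_lipschitz (X : normedModType R) (g : X -> R) : Prop :=
  forall x : X, exists r : R, 0 < r /\ exists L : R,
    forall y z : X, `|y - x| < r -> `|z - x| < r -> `|g y - g z| <= L * `|y - z|.

(* Clarke generalized directional derivative
   g^0(x;v) = limsup_{y -> x, lambda \searrow 0} (g(y + lambda v) - g y)/lambda
            = inf_{delta > 0} sup_{|y-x|<delta, 0<lambda<delta} ... *)
Definition clarke_dd (X : normedModType R) (g : X -> R) (x v : X) : \bar R :=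
  ereal_inf [set ereal_sup [set ((g (yl.1 + yl.2 *: v) - g yl.1) / yl.2)%:E
                           | yl in [set yl : X * R | `|yl.1 - x| < delta /\
                                     0 < yl.2 /\ yl.2 < delta]]
            | delta in [set d : R | 0 < d]].

Definition clarke_subdiff (X : normedModType R) (g : X -> R) (x : X) : set (X -> R) :=
  [set xi | @dual X xi /\ forall v : X, ((xi v)%:E <= clarke_dd g x v)%E].

End Defs.
Arguments is_linear {R V W} T.
Arguments dual {R} V.
Arguments opnorm {R V W} T.
Arguments dual_norm {R V} xi.
Arguments reflexive_space {R} V.
Arguments locally_lipschitz {R X} g.
Arguments clarke_dd {R X} g x v.
Arguments clarke_subdiff {R X} g x.

(* Main.v *)
(* Problem (I) at u is the hemivariational inequality
     0 <= <Au - f, v> + J_2^0(gamma u, gamma u; gamma v)  for all v,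
   one direction being Hahn-Banach for the sublinear map J_2^0(gamma u, gamma u; .),
   and a solution of (O) satisfies it because the Clarke derivative of L(u, .) is
   at most the right-hand side.  By Lebourg's mean value inequality, the one-sided
   condition (J3) with w1 = w2 makes J(w, .) + m_alpha |.|^2 / 2 midpoint convex
   along lines; with (A3) and (S) each L(w, .) is then strongly midpoint convex,
   so minimizing sequences are Cauchy and a minimizer Lambda(w) exists.  Adding two
   hemivariational inequalities and using (J3) shows that Lambda is a contraction,
   and its fixed point solves (O).  The same computation gives uniqueness for (I),
   hence (I) => (O), and comparison with w2 = v2 = 0 in (J3) gives the bound. *)
Require Import Defs.
From HB Require Import structures.
From mathcomp Require Import all_boot all_order all_algebra.
From mathcomp Require Import all_classical all_reals all_analysis.
From mathcomp Require Import ring lra.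
Import Order.TTheory GRing.Theory Num.Theory.
Import numFieldNormedType.Exports.
Local Open Scope classical_set_scope.
Local Open Scope ring_scope.
Set Implicit Arguments.
Unset Strict Implicit.
Unset Printing Implicit Defensive.

(** * Sublinear functionals and the Hahn-Banach theorem *)

Section Sublinear.
Context {R : realType} {V : lmodType R}.
Implicit Types p q : V -> R.

(** Homogeneity is asked only as an inequality; applying it to [t^-1] as well gives equality for
    positive [t], as [sublinearZ] records. *)
Definition sublinear p :=
  (forall x y, p (x + y) <= p x + p y) /\
  (forall t x, 0 <= t -> p (t *: x) <= t * p x).

Lemma sublinear0 p : sublinear p -> p 0 = 0.
Proof.
move=> [pD pZ]; apply/eqP; rewrite eq_le.
have := pZ 0 0 (lexx _); rewrite scale0r mul0r => -> /=.
by have := pD 0 0; rewrite addr0 lerDl.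
Qed.

Lemma sublinearN p x : sublinear p -> - p (- x) <= p x.
Proof.
move=> sp; have [pD _] := sp; rewrite lerNl -subr_ge0 opprK addrC.
by have := pD x (- x); rewrite subrr (sublinear0 sp).
Qed.

Lemma sublinearZ p t x : sublinear p -> 0 <= t -> p (t *: x) = t * p x.
Proof.
move=> sp; have [_ pZ] := sp; rewrite le_eqVlt => /predU1P[<-|t0].
  by rewrite scale0r mul0r (sublinear0 sp).
apply/eqP; rewrite eq_le (pZ _ _ (ltW t0))/= -ler_pdivlMl//.
have := pZ t^-1 (t *: x); rewrite scalerA mulVf ?gt_eqF// scale1r invr_ge0.
by apply; exact: ltW.
Qed.

(** The witness is the infimum of [p (x + k.1) - k.2] over the convex cone [K]; subadditivity and
    [k.2 <= p k.1] bound it below by [- p (- x)]. A linear functional below [q] lies below [p] and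
    takes a value at least [k.2] at [k.1], so [K] encodes lower constraints on such functionals. *)
Lemma sublinear_inf_cone p (K : set (V * R)) : sublinear p ->
  K (0, 0) ->
  (forall k l, K k -> K l -> K (k.1 + l.1, k.2 + l.2)) ->
  (forall t k, 0 <= t -> K k -> K (t *: k.1, t * k.2)) ->
  (forall k, K k -> k.2 <= p k.1) ->
  exists q, [/\ sublinear q, forall x, q x <= p x &
    forall k, K k -> q (- k.1) <= - k.2].
Proof.
move=> sp K0 KD KZ Kp; have [pD pZ] := sp.
pose q x := inf [set p (x + k.1) - k.2 | k in K].
have q_le x k : K k -> q x <= p (x + k.1) - k.2.
  move=> Kk; apply: ge_inf; last by exists k.
  exists (- p (- x)) => _ [l Kl <-]; have := Kp _ Kl.
  have := pD (x + l.1) (- x); rewrite addrAC subrr add0r; lra.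
have q_ge x m : (forall k, K k -> m <= p (x + k.1) - k.2) -> m <= q x.
  move=> H; apply: lb_le_inf; first by exists (p (x + 0) - 0), (0, 0).
  by move=> _ [k Kk <-]; exact: H.
exists q; split.
- split=> [x y|t x].
    rewrite -lerBlDr; apply/q_ge => k Kk.
    rewrite lerBlDr -lerBlDl; apply/q_ge => l Kl.
    have := q_le (x + y) _ (KD _ _ Kk Kl) => /=.
    have := pD (x + k.1) (y + l.1); rewrite addrACA; lra.
  rewrite le_eqVlt => /predU1P[<-|t0].
    rewrite scale0r mul0r; have := q_le 0 _ K0.
    by rewrite /= addr0 subr0 (sublinear0 sp).
  rewrite -ler_pdivrMl//; apply/q_ge => k Kk; rewrite ler_pdivrMl//.
  have := q_le (t *: x) _ (KZ _ _ (ltW t0) Kk) => /=.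
  rewrite -scalerDr; have := pZ t (x + k.1) (ltW t0); lra.
- by move=> x; have := q_le x _ K0; rewrite /= addr0 subr0.
- by move=> k Kk; have := q_le (- k.1) _ Kk; rewrite addNr (sublinear0 sp) sub0r.
Qed.

(** The pointwise infimum works, being bounded below by [- p (- x)]. For subadditivity, of two
    members tested at [x] and at [y] the smaller one is used at [x + y]; this is where the chain
    must be totally ordered. *)
Lemma sublinear_inf_chain p (C : set (V -> R)) : sublinear p -> C !=set0 ->
  (forall q, C q -> sublinear q /\ forall x, q x <= p x) ->
  (forall q r, C q -> C r ->
    (forall x, q x <= r x) \/ (forall x, r x <= q x)) ->
  exists q, [/\ sublinear q, forall x, q x <= p x &
    forall r, C r -> forall x, q x <= r x].
Proof.
move=> sp [q0 Cq0] Cp Ctot; have [pD pZ] := sp.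
pose q x := inf [set r x | r in C].
have q_le x r : C r -> q x <= r x.
  move=> Cr; apply: ge_inf; last by exists r.
  exists (- p (- x)) => _ [s /Cp[ss sp'] <-].
  by apply: le_trans (sublinearN x ss); rewrite lerN2.
have q_ge x m : (forall r, C r -> m <= r x) -> m <= q x.
  move=> H; apply: lb_le_inf; first by exists (q0 x), q0.
  by move=> _ [k Kk <-]; exact: H.
exists q; split.
- split=> [x y|t x t0].
    rewrite -lerBlDr; apply/q_ge => r Cr.
    rewrite lerBlDr -lerBlDl; apply/q_ge => s Cs.
    have [[rD _] _] := Cp _ Cr; have [[sD _] _] := Cp _ Cs.
    have [rs|sr] := Ctot _ _ Cr Cs.
      have := q_le (x + y) _ Cr; have := rD x y; have := rs y; lra.
    have := q_le (x + y) _ Cs; have := sD x y; have := sr x; lra.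
  have [->|tn0] := eqVneq t 0.
    rewrite scale0r mul0r; have := q_le 0 _ Cq0.
    by have [/sublinear0 -> _] := Cp _ Cq0.
  have {tn0 t0} t0 : 0 < t by rewrite lt_def tn0.
  rewrite -ler_pdivrMl//; apply/q_ge => r Cr; rewrite ler_pdivrMl//.
  by apply: le_trans (q_le _ _ Cr) _; have [[_ rZ] _] := Cp _ Cr; apply/rZ/ltW.
- by move=> x; apply: le_trans (q_le _ _ Cq0) _; have [] := Cp _ Cq0.
- by move=> r Cr x; exact: q_le.
Qed.

(* A minimal sublinear functional below p is linear. *)
Lemma hahn_banach_sublinear p : sublinear p ->
  exists xi : V -> R, (forall a x y, xi (a *: x + y) = a * xi x + xi y) /\
    forall x, xi x <= p x.
Proof.
move=> sp.
pose T := {q : V -> R | sublinear q /\ forall x, q x <= p x}.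
(* The order is reversed, so that a maximal element in Zorn's lemma is a minimal functional. *)
pose le (q r : T) : bool := `[< forall x, sval r x <= sval q x >].
have t0 : T by exists p; split.
have [|||[q [sq qp]] qmin] := @ZL_preorder T t0 le.
- by move=> t; apply/asboolP.
- move=> r s t /asboolP rs /asboolP st; apply/asboolP => x.
  exact: le_trans (st x) (rs x).
- move=> A Atot; have [[a Aa]|A0] := pselect (A !=set0); last first.
    by exists t0 => s As; exfalso; apply: A0; exists s.
  have [||q r [s As <-] [t At <-]|q [sq qp qA]] :=
      @sublinear_inf_chain p [set sval q | q in A] sp.
  + by exists (sval a), a.
  + by move=> _ [[q qP] _ <-].
  + by case: (Atot _ _ As At) => /asboolP H; [right|left].
  + exists (exist _ q (conj sq qp)) => s As; apply/asboolP => x /=.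
    by apply: qA; exists s.
have {}qmin r : sublinear r -> (forall x, r x <= q x) -> forall x, q x <= r x.
  move=> sr rq; have rp x := le_trans (rq x) (qp x).
  have /(_ _)/asboolP := qmin (exist _ r (conj sr rp)).
  by apply; apply/asboolP.
have [qD qZ] := sq.
have qD' x y : q (x + y) = q x + q y.
  apply/eqP; rewrite eq_le qD/=.
  (* The ray through [(y, q y)] yields a sublinear [r] below [q] with [r (- y) <= - q y]. Minimality
     forces [r] to agree with [q], and subadditivity of [r] on [x = (x + y) + (- y)] gives
     [q x + q y <= q (x + y)]. *)
  pose K := [set (t *: y, t * q y) | t in [set t : R | 0 <= t]].
  have [||||r [sr rq rK]] := @sublinear_inf_cone q K sq.
  - by exists 0 => //=; rewrite scale0r mul0r.
  - move=> _ _ [t /= t_ge0 <-] [s /= s0 <-]; exists (t + s) => /=.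
      exact: addr_ge0.
    by rewrite scalerDl mulrDl.
  - move=> s _ s0 [t /= t_ge0 <-]; exists (s * t); first exact: mulr_ge0.
    by rewrite /= scalerA mulrA.
  - by move=> _ [t /= t_ge0 <-] /=; rewrite (sublinearZ _ sq).
  - have := qmin _ sr rq (x + y) => qr.
    have [rD _] := sr; have := rD (x + y) (- y); rewrite addrK.
    have := rK (y, q y) _; rewrite /= => rNy.
    have := qmin _ sr rq x; have := rq (x + y).
    suff: r (- y) <= - q y by lra.
    by apply: rNy; exists 1; rewrite /= ?scale1r ?mul1r.
have qN x : q (- x) = - q x.
  by apply/eqP; rewrite -addr_eq0 -qD' addNr (sublinear0 sq).
exists q; split=> // a x y; rewrite qD'; congr (_ + _).
have [a0|a0] := leP 0 a; first exact: sublinearZ.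
by apply: oppr_inj; rewrite -qN -scaleNr (sublinearZ _ sq) ?mulNr// oppr_ge0 ltW.
Qed.

End Sublinear.

(** * The Clarke directional derivative of a locally Lipschitz function *)

Section ClarkeDerivative.
Context {R : realType} {X : normedModType R}.
Implicit Types (g : X -> R) (x y v : X) (a l delta : R).

Lemma clarke_dd_le g x v a delta : 0 < delta ->
  (forall y l, `|y - x| < delta -> 0 < l -> l < delta ->
    (g (y + l *: v) - g y) / l <= a) ->
  (clarke_dd g x v <= a%:E)%E.
Proof.
move=> d0 H; apply: (@le_trans _ _ (ereal_sup
  [set ((g (yl.1 + yl.2 *: v) - g yl.1) / yl.2)%:E
     | yl in [set yl : X * R | `|yl.1 - x| < delta /\ 0 < yl.2 /\ yl.2 < delta]])).
  by apply: ereal_inf_lbound; exists delta.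
apply: ge_ereal_sup => _ [[y l] /= [yx [l0 ld]] <-].
by rewrite lee_fin; exact: H.
Qed.

Lemma clarke_dd_ge g x v a :
  (forall delta, 0 < delta -> exists y l, [/\ `|y - x| < delta, 0 < l,
    l < delta & a <= (g (y + l *: v) - g y) / l]) ->
  (a%:E <= clarke_dd g x v)%E.
Proof.
move=> H; apply: le_ereal_inf_tmp => _ [delta /= d0 <-].
have [y [l [yx l0 ld ag]]] := H _ d0.
apply: (@le_trans _ _ ((g (y + l *: v) - g y) / l)%:E); first by rewrite lee_fin.
by apply: ereal_sup_ubound; exists (y, l).
Qed.

Lemma clarke_dd_lt g x v a : (clarke_dd g x v < a%:E)%E ->
  exists2 delta, 0 < delta & forall y l, `|y - x| < delta -> 0 < l -> l < delta ->
    (g (y + l *: v) - g y) / l <= a.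
Proof.
move=> /ereal_inf_lt[_ [delta /= d0 <-] lta]; exists delta => // y l yx l0 ld.
rewrite -lee_fin; apply: le_trans (ltW lta).
by apply: ereal_sup_ubound; exists (y, l).
Qed.

Lemma norm_shift_lt x y v l delta : `|y - x| < delta -> 0 < l -> l < delta ->
  `|y + l *: v - x| < delta * (1 + `|v|).
Proof.
move=> yx l0 ld; rewrite addrAC (le_lt_trans (ler_normD _ _))//.
by rewrite mulrDr mulr1 ltr_leD// normrZ gtr0_norm// ler_wpM2r// ltW.
Qed.

Lemma locally_lipschitz_ge0 g x : locally_lipschitz g ->
  exists r L, [/\ 0 < r, 0 <= L & forall y z, `|y - x| < r -> `|z - x| < r ->
    `|g y - g z| <= L * `|y - z|].
Proof.
move=> /(_ x)[r [r0 [L H]]]; exists r, `|L|; split=> // y z yx zx.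
by apply: le_trans (H _ _ yx zx) _; rewrite ler_wpM2r// ler_norm.
Qed.

(** The Lipschitz constant near [x] serves all directions at once; only the radius shrinks with [v],
    to keep [y + l *: v] in the Lipschitz ball. This uniformity later makes linear functionals below
    the Clarke derivative continuous. *)
Lemma locally_lipschitz_quotient g x : locally_lipschitz g ->
  exists2 L, 0 <= L & forall v, exists2 delta, 0 < delta &
    forall y l, `|y - x| < delta -> 0 < l -> l < delta ->
    `|(g (y + l *: v) - g y) / l| <= L * `|v|.
Proof.
move=> /(@locally_lipschitz_ge0 _ x)[r [L [r0 L0 H]]]; exists L => // v.
have v1 : 0 < 1 + `|v| by rewrite ltr_pwDl.
exists (r / (1 + `|v|)) => [|y l yx l0 ld]; first exact: divr_gt0.
have := norm_shift_lt v yx l0 ld; rewrite divfK ?gt_eqF// => yr.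
rewrite normrM normfV (gtr0_norm l0) ler_pdivrMr//.
have {yr}/H : `|y + l *: v - x| < r by [].
move=> /(_ y); rewrite [y + _]addrC addrK normrZ (gtr0_norm l0) mulrAC -mulrA.
apply; apply: lt_le_trans yx _.
by rewrite ler_pdivrMr// ler_peMr ?(ltW r0)// lerDl.
Qed.

Lemma clarke_dd_bounds g x : locally_lipschitz g ->
  exists2 L, 0 <= L & forall v,
    ((- (L * `|v|))%:E <= clarke_dd g x v <= (L * `|v|)%:E)%E.
Proof.
move=> /(@locally_lipschitz_quotient _ x)[L L0 H]; exists L => // v.
have [d0 d0_gt0 Hd] := H v; apply/andP; split; last first.
  apply: (clarke_dd_le d0_gt0) => y l yx l0 ld.
  exact: le_trans (ler_norm _) (Hd _ _ yx l0 ld).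
apply: clarke_dd_ge => d d_gt0; pose l := Num.min d d0 / 2.
have m0 : 0 < Num.min d d0 by rewrite lt_min d_gt0.
have l0 : 0 < l by rewrite divr_gt0.
have : l < Num.min d d0 by rewrite ltr_pdivrMr// ltr_pMr// ltr1n.
rewrite lt_min => /andP[ld ld0].
exists x, l; rewrite subrr normr0; split=> //.
by have := Hd x l; rewrite subrr normr0 ler_norml => /(_ d0_gt0 l0 ld0)/andP[].
Qed.

(** A real-valued form, to which the sublinear theory applies. The value 0 that [fine] gives to
    infinities does not occur for locally Lipschitz [g], by [clarke_dirE]. *)
Definition clarke_dir g x v : R := fine (clarke_dd g x v).

Lemma clarke_dirE g x v : locally_lipschitz g ->
  clarke_dd g x v = (clarke_dir g x v)%:E.
Proof.
move=> /(@clarke_dd_bounds _ x)[L _ /(_ v)/andP[lo hi]].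
rewrite /clarke_dir fineK// fin_numElt.
by rewrite (lt_le_trans (ltNyr _) lo) (le_lt_trans hi (ltry _)).
Qed.

Lemma clarke_dir_bound g x : locally_lipschitz g ->
  exists2 L, 0 <= L & forall v, `|clarke_dir g x v| <= L * `|v|.
Proof.
move=> gL; have [L L0 H] := clarke_dd_bounds x gL; exists L => // v.
by rewrite ler_norml; have := H v; rewrite clarke_dirE// !lee_fin.
Qed.

Lemma clarke_dir_lt g x v a : locally_lipschitz g -> clarke_dir g x v < a ->
  exists2 delta, 0 < delta & forall y l, `|y - x| < delta -> 0 < l -> l < delta ->
    (g (y + l *: v) - g y) / l <= a.
Proof. by move=> gL ga; apply: clarke_dd_lt; rewrite clarke_dirE// lte_fin. Qed.

(** The quotient in direction [u + v] splits at [y + l *: u], a base point that still tends to [x].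
    Homogeneity comes from rescaling the step [l] by [t]. *)
Lemma sublinear_clarke_dir g x : locally_lipschitz g ->
  sublinear (clarke_dir g x).
Proof.
move=> gL; split=> [u v|t v].
  apply/ler_addgt0Pr => e e0.
  have e2 : 0 < e / 2 by rewrite divr_gt0.
  have [|du du0 Hu] := @clarke_dir_lt g x u (clarke_dir g x u + e / 2) gL.
    by rewrite ltrDl.
  have [|dv dv0 Hv] := @clarke_dir_lt g x v (clarke_dir g x v + e / 2) gL.
    by rewrite ltrDl.
  have u1 : 0 < 1 + `|u| by rewrite ltr_pwDl.
  pose d := Num.min du (dv / (1 + `|u|)).
  have d0 : 0 < d by rewrite lt_min du0 divr_gt0.
  rewrite -lee_fin -clarke_dirE//; apply: (clarke_dd_le d0) => y l yx l0 ld.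
  have dv_d : d * (1 + `|u|) <= dv by rewrite -ler_pdivlMr// ge_min lexx orbT.
  have d_dv : d <= dv.
    by apply: le_trans dv_d; rewrite ler_peMr ?(ltW d0)// lerDl.
  have d_du : d <= du by rewrite ge_min lexx.
  have := Hu y l (lt_le_trans yx d_du) l0 (lt_le_trans ld d_du).
  have := Hv (y + l *: u) l _ l0 (lt_le_trans ld d_dv).
  move=> /(_ (lt_le_trans (norm_shift_lt u yx l0 ld) dv_d)).
  rewrite -addrA -scalerDr.
  rewrite [(g (_ + l *: (u + v)) - g y) / l](_ : _ =
    (g (y + l *: u) - g y) / l +
    (g (y + l *: (u + v)) - g (y + l *: u)) / l);
    last by rewrite -mulrDl; congr (_ / _); lra.
  lra.
rewrite le_eqVlt => /predU1P[<-|t0].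
  rewrite scale0r mul0r -lee_fin -clarke_dirE//.
  apply: (@clarke_dd_le _ _ _ _ 1) => // y l _ _ _.
  by rewrite scaler0 addr0 subrr mul0r.
rewrite -ler_pdivrMl//; apply/ler_addgt0Pr => e e0; rewrite ler_pdivrMl//.
have [|d d0 H] := @clarke_dir_lt g x v (clarke_dir g x v + e) gL.
  by rewrite ltrDl.
have m0 : 0 < Num.min d (d / t) by rewrite lt_min d0 divr_gt0.
rewrite -lee_fin -clarke_dirE//; apply: (clarke_dd_le m0) => y l.
rewrite !lt_min => /andP[yx _] l0 /andP[_ ldt].
have := H y (l * t) yx (mulr_gt0 l0 t0); rewrite -ltr_pdivlMr// => /(_ ldt).
by rewrite -scalerA invfM mulrA ler_pdivrMr// [_ * t]mulrC.
Qed.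

End ClarkeDerivative.

(** * Mean value inequality, midpoint convexity and existence of minimizers *)

Section SemiconvexFunctions.
Context {R : realType}.

(* By real induction: were every t to admit a delta below which the slopes of
   h around t are < K, the slope of h over [a, b] would be < K as well. *)
Lemma slope_concentration (h : R -> R) (a b K : R) : a < b ->
  K * (b - a) <= h b - h a ->
  exists2 t, a <= t <= b & forall delta, 0 < delta ->
    exists a' b', [/\ a' <= t <= b', a' < b', b' - a' < delta &
      K * (b' - a') <= h b' - h a'].
Proof.
move=> ab slope; apply: contrapT => noT.
have {}noT t : a <= t <= b -> exists2 delta, 0 < delta &
    forall a' b', a' <= t <= b' -> a' < b' -> b' - a' < delta ->
      h b' - h a' < K * (b' - a').
  move=> tab; apply: contrapT => noD; apply: noT; exists t => // delta d0.
  apply: contrapT => noab; apply: noD; exists delta => // a' b' t1 t2 t3.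
  by rewrite ltNge; apply/negP => t4; apply: noab; exists a', b'.
pose S := [set s | a <= s <= b /\ (s = a \/ h s - h a < K * (s - a))].
have Sa : S a by split; [rewrite lexx ltW|left].
have Sb : ubound S b by move=> s [/andP[]].
have supS : has_sup S by split; [exists a|exists b].
pose c := sup S.
have ac : a <= c by apply: sup_upper_bound.
have cb : c <= b by apply: ge_sup => //; exists a.
have [|d d0 Hd] := noT c; first by rewrite ac cb.
have [s [/andP[as_ sb] Ss] cs] := sup_adherent d0 supS.
have sc : s <= c by apply: sup_upper_bound => //; split=> //; rewrite as_.
have step u : c <= u -> u - s < d -> s < u -> h u - h a < K * (u - a).
  move=> cu usd su; have := Hd s u; rewrite sc cu => /(_ isT su usd).
  case: Ss => [->//|]; lra.
have {}slope : ~ h b - h a < K * (b - a) by apply/negP; rewrite -leNgt.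
have [cb'|bc] := ltP c b; last first.
  have cE : c = b by apply/eqP; rewrite eq_le cb.
  have [sb'|bs] := ltP s b.
    by apply/slope/step; rewrite ?cE//; move: cs; rewrite -/c cE; lra.
  have sE : s = b by apply/eqP; rewrite eq_le sb.
  by case: Ss; rewrite sE => // ba; move: ab; rewrite ba ltxx.
(* Half of the slack [d - (c - s)] puts [u] beyond the supremum [c] but still within [d] of [s], so
   [step] places [u] in [S], a contradiction. *)
pose u := Num.min b (c + (d - (c - s)) / 2).
have dcs : 0 < d - (c - s) by move: cs; rewrite -/c; lra.
have cu : c < u by rewrite lt_min cb' ltrDl divr_gt0.
have ud : u - s < d.
  have : u <= c + (d - (c - s)) / 2 by rewrite ge_min lexx orbT.
  lra.
suff : u <= c by rewrite leNgt cu.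
apply: sup_upper_bound => //; split; first by rewrite ge_min lexx (le_trans ac (ltW cu)).
by right; apply: step => //; [exact: ltW|exact: le_lt_trans sc cu].
Qed.

Context {X : normedModType R}.
Implicit Types (g : X -> R) (p d : X).

(* Lebourg's mean value inequality for g + m |d|^2 t^2 / 2 along the line p + t d. *)
Lemma lebourg_mean_value g p d (m a b K : R) : locally_lipschitz g ->
  0 <= m -> a < b ->
  let psi t := g (p + t *: d) + m / 2 * t ^+ 2 in
  K * (b - a) <= psi b - psi a ->
  exists2 t, a <= t <= b & K <= clarke_dir g (p + t *: d) d + m * t.
Proof.
move=> gL m0 ab psi slope.
have [t tab Ht] := slope_concentration ab slope; exists t => //.
rewrite -lerBlDr; apply/ler_addgt0Pr => e e0.
rewrite -lerBlDr -lee_fin -clarke_dirE//.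
apply: clarke_dd_ge => delta delta0.
have d1 : 0 < 1 + `|d| by rewrite ltr_pwDl.
have m1 : 0 < 1 + m by rewrite ltr_pwDl.
(* The first bound keeps both the base point and the step within [delta]; the second keeps the chord
   slope of the quadratic term, [m / 2 * (a' + b')], below [m * t + e]. *)
pose eta := Num.min (delta / (1 + `|d|)) (e / (1 + m)).
have eta0 : 0 < eta by rewrite lt_min !divr_gt0.
have [a' [b' [/andP[at' tb'] ab']]] := Ht _ eta0.
rewrite lt_min => /andP[bad bae] slope'.
exists (p + a' *: d), (b' - a'); have l0 : 0 < b' - a' by rewrite subr_gt0.
split=> //.
- rewrite opprD addrACA subrr add0r -scalerBl normrZ.
  rewrite ltr_pdivlMr// in bad; apply: le_lt_trans bad.
  apply: ler_pM => //; last by rewrite lerDr.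
  rewrite distrC ger0_norm ?subr_ge0//; lra.
- apply: lt_le_trans bad _; rewrite ler_pdivrMr//.
  by rewrite ler_peMr ?lerDl ?(ltW delta0).
rewrite ler_pdivlMr// -[p + _ + _]addrA -scalerDl [a' + _]addrC subrK.
rewrite ltr_pdivlMr// in bae.
move: slope'; rewrite /psi => slope'.
have : m / 2 * b' ^+ 2 - m / 2 * a' ^+ 2 <= (m * t + e) * (b' - a').
  have -> : m / 2 * b' ^+ 2 - m / 2 * a' ^+ 2 = (m / 2 * (b' + a')) * (b' - a') by field.
  rewrite ler_wpM2r ?(ltW l0)//.
  have : m * (a' + b' - 2 * t) <= m * (b' - a') by rewrite ler_wpM2l//; lra.
  have : 0 <= b' - a' by rewrite ltW.
  lra.
lra.
Qed.

(* Lebourg's inequality on [0, 1/2 - eps] and [1/2, 1], and eps -> 0. *)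
Lemma clarke_monotone_midpoint g (m : R) : locally_lipschitz g -> 0 <= m ->
  (forall x y, clarke_dir g x (y - x) + clarke_dir g y (x - y) <=
    m * `|x - y| ^+ 2) ->
  forall x y, 2 * g (2^-1 *: (x + y)) <= g x + g y + m / 4 * `|x - y| ^+ 2.
Proof.
move=> gL m0 mono x y; pose d := y - x.
(* The constant [m] rescaled to the parameter of the line: points at parameters [s] and [t] are |s -
   t| |d| apart. *)
pose M := m * `|d| ^+ 2.
have M0 : 0 <= M by rewrite mulr_ge0 ?exprn_ge0.
pose psi t := g (x + t *: d) + M / 2 * t ^+ 2.
have lineB u v : x + u *: d - (x + v *: d) = (u - v) *: d.
  by rewrite opprD addrACA subrr add0r -scalerBl.
(* Chord slopes of [psi] increase. Lebourg along [d] on the left interval and along [- d] on the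
   reflected right one gives points [s <= b] and [t' >= c], where the one-sided condition, divided
   by [t' - s], compares the two derivatives. The gap [b < c] makes this divisor positive. *)
have slopes (a b c e : R) : a < b -> b < c -> c < e ->
    (psi b - psi a) / (b - a) <= (psi e - psi c) / (e - c).
  move=> ab bc ce.
  have [|s sab Hs] := @lebourg_mean_value g x d M a b
      ((psi b - psi a) / (b - a)) gL M0 ab.
    by rewrite divfK// gt_eqF// subr_gt0.
  have [||t /andP[t1 t2] Ht] := @lebourg_mean_value g x (- d) M (- e) (- c)
      (- ((psi e - psi c) / (e - c))) gL M0.
  - by rewrite ltrN2.
  - rewrite opprK [- c + e]addrC mulNr divfK ?gt_eqF ?subr_gt0//.
    by rewrite !scalerN !scaleNr !opprK !sqrrN /psi; lra.
  pose t' := - t; have tE : t = - t' by rewrite opprK.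
  have st : 0 < t' - s.
    by rewrite subr_gt0; move: sab t2; rewrite tE => /andP[_ sb]; lra.
  have := mono (x + s *: d) (x + t' *: d).
  rewrite !lineB.
  have -> : (s - t') *: d = (t' - s) *: - d by rewrite scalerN -scaleNr opprB.
  rewrite !(sublinearZ _ (sublinear_clarke_dir _ gL)) ?(ltW st)//.
  rewrite normrZ normrN (gtr0_norm st) exprMn mulrCA -/M expr2 -mulrDr -mulrA.
  rewrite ler_pM2l// mulrC => H.
  move: Ht; rewrite tE scaleNr scalerN opprK mulrN => Ht.
  lra.
have midE : 2^-1 *: (x + y) = x + 2^-1 *: d.
  rewrite /d scalerBr scalerDr [RHS]addrCA [RHS]addrC; congr (_ + _).
  by rewrite -[X in _ = X - _]scale1r -scalerBl; congr (_ *: _); field.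
suff : psi 2^-1 - psi 0 <= psi 1 - psi 2^-1.
  rewrite /psi scale0r addr0 scale1r midE [x + d]addrC subrK distrC -/d.
  have -> : m / 4 * `|d| ^+ 2 = M / 4 by rewrite /M; field.
  lra.
have [r [L [r0 L0 HL]]] := locally_lipschitz_ge0 (x + 2^-1 *: d) gL.
set D := psi 1 - psi 2^-1.
have nd : 0 < 1 + `|d| by rewrite ltr_pwDl.
(* The cost per unit of [eps] of leaving the gap: the interval of length [2^-1 - eps] against the
   slope [2 * D], the Lipschitz variation of [g] across the gap, and that of the quadratic term. *)
pose C := 1 + (2 * `|D| + L * `|d| + M / 2).
have C0 : 0 < C by rewrite ltr_pwDl// !addr_ge0 ?mulr_ge0.
apply/ler_addgt0Pr => e e0.
pose eps := Num.min 4^-1 (Num.min (r / (1 + `|d|)) (e / C)).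
have eps0 : 0 < eps by rewrite !lt_min invr_gt0 ltr0n !divr_gt0.
have : eps <= 4^-1 by rewrite ge_min lexx.
have : eps <= r / (1 + `|d|) by rewrite !ge_min lexx orbT.
have : eps <= e / C by rewrite !ge_min lexx !orbT.
rewrite !ler_pdivlMr// => epsC epsr eps4.
have := @slopes 0 (2^-1 - eps) 2^-1 1.
have -> : 1 - 2^-1 = 2^-1 :> R by field.
rewrite invrK subr0 -/D ler_pdivrMr; last lra.
move=> /(_ ltac:(lra) ltac:(lra) ltac:(lra)) Hs.
have := HL (x + 2^-1 *: d) (x + (2^-1 - eps) *: d).
rewrite subrr normr0 !lineB !normrZ.
rewrite subKr addrAC subrr add0r normrN (gtr0_norm eps0).
have epsd : eps * `|d| < r.
  by apply: lt_le_trans epsr; rewrite ltr_pM2l// ltrDr.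
move=> /(_ r0 epsd).
rewrite ler_norml => /andP[_ HD].
have HM : M / 2 * (eps - eps ^+ 2) <= M / 2 * eps.
  by rewrite ler_wpM2l ?divr_ge0// gerBl exprn_ge0// ltW.
have HD2 : - (eps * D) <= eps * `|D| by rewrite -mulrN ler_pM2l// -normrN ler_norm.
move: epsC; rewrite /C; move: Hs; rewrite /psi => Hs.
lra.
Qed.

(** Boundedness below follows from a linear lower bound, spread from a ball to the whole space,
    which the quadratic term then dominates. With infimum [mu], the hypothesis bounds k |x - y|^2 by
    [G x + G y - 2 * mu], so a minimizing sequence converges, and the Lipschitz bound at its limit
    carries the infimum over. *)
Lemma midpoint_convex_minimizer (W : completeNormedModType R) (G : W -> R) (k : R) :
  0 < k -> locally_lipschitz G ->
  (forall x y, 2 * G (2^-1 *: (x + y)) + k * `|x - y| ^+ 2 <= G x + G y) ->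
  exists u, forall v, G u <= G v.
Proof.
move=> k0 GL Gmid.
have half (x : W) : `|2^-1 *: x| = `|x| / 2 by rewrite normrZ gtr0_norm// mulrC.
have [r [L [r0 L0 HL]]] := locally_lipschitz_ge0 0 GL.
have G2 x : 2 * (G (2^-1 *: x) - G 0) + k * `|x| ^+ 2 <= G x - G 0.
  by have := Gmid x 0; rewrite addr0 subr0; lra.
(* Each halving of [x] doubles the radius on which the bound holds, since [G2] gives
   [G x - G 0 >= 2 * (G (2^-1 *: x) - G 0)]. *)
have Gn n x : `|x| < r * 2 ^+ n -> - (L * `|x|) <= G x - G 0.
  elim: n x => [|n IHn] x.
    rewrite expr0 mulr1 => xr; have := HL x 0; rewrite !subr0 normr0 => /(_ xr r0).
    by rewrite ler_norml => /andP[].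
  move=> xr; have := IHn (2^-1 *: x).
  rewrite half ltr_pdivrMr// -mulrA -exprSr => /(_ xr).
  have := G2 x; have : 0 <= k * `|x| ^+ 2 by rewrite mulr_ge0 ?exprn_ge0// ltW.
  lra.
have Gb x : - (L * `|x|) <= G x - G 0.
  apply: (Gn (Num.bound (`|x| / r))); rewrite -ltr_pdivrMl// mulrC.
  apply: lt_trans (archi_boundP _) _; first by rewrite divr_ge0// ltW.
  by rewrite -natrX ltr_nat ltn_expl.
have Glb x : G 0 - L ^+ 2 / (4 * k) <= G x.
  have := G2 x; have := Gb (2^-1 *: x); rewrite half => H1 H2.
  (* [G2] and [Gb] at [2^-1 *: x] give [G x - G 0] at least k |x|^2 - L |x|; completing the square
     finds the minimum of this quadratic. *)
  have : 0 <= k * (`|x| - L / (2 * k)) ^+ 2 by rewrite mulr_ge0 ?exprn_even_ge0// ltW.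
  have -> : k * (`|x| - L / (2 * k)) ^+ 2 =
    k * `|x| ^+ 2 - L * `|x| + L ^+ 2 / (4 * k) by field; rewrite gt_eqF.
  lra.
have infG : has_inf (range G).
  split; first by exists (G 0), 0.
  by exists (G 0 - L ^+ 2 / (4 * k)) => _ [x _ <-].
pose mu := inf (range G).
have mu_le x : mu <= G x by apply: ge_inf; [case: infG|exists x].
have /choice[w Hw] (n : nat) : exists x, G x < mu + n.+1%:R^-1.
  have [|_ [x _ <-] H] := @inf_adherent _ (range G) n.+1%:R^-1 _ infG.
    by rewrite invr_gt0.
  by exists x.
have small (e : R) : 0 < e -> exists N, forall n, (N <= n)%N -> n.+1%:R^-1 < e.
  move=> e0; exists (Num.bound e^-1) => n Nn.
  rewrite invf_plt ?posrE//; apply: lt_le_trans (archi_boundP _) _.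
    by rewrite invr_ge0 ltW.
  by rewrite ler_nat ltnW.
have : cauchy (w @ \oo).
  apply: cauchy_exP => e e0; have ke0 : 0 < k * e ^+ 2 / 2.
    by rewrite divr_gt0// mulr_gt0// exprn_gt0.
  have [N HN] := small _ ke0; exists (w N); exists N => // n /= Nn.
  rewrite -ball_normE /ball_ /= -(ltr_pXn2r (_ : 0 < 2)%N) ?nnegrE ?(ltW e0)//.
  rewrite -(ltr_pM2l k0).
  have := Gmid (w N) (w n); have := mu_le (2^-1 *: (w N + w n)).
  have := Hw N; have := Hw n; have := HN N (leqnn _); have := HN n Nn.
  move: (N.+1%:R^-1 : R) (n.+1%:R^-1 : R) => a b; lra.
move=> /cauchy_cvgP wu; exists (lim (w @ \oo)) => v; set u := lim _.
apply: le_trans (mu_le v); apply/ler_addgt0Pr => e e0.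
have [r' [L' [r'0 L'0 HL']]] := locally_lipschitz_ge0 u GL.
have d0 : 0 < Num.min r' (e / 2 / (1 + L')).
  by rewrite lt_min r'0 !divr_gt0// ltr_pwDl.
have /cvgrPdist_lt/(_ _ d0)[N1 _ HN1] : w @ \oo --> u := wu.
have [N2 HN2] := small (e / 2) (divr_gt0 e0 (ltr0Sn _ _)).
pose n := maxn N1 N2.
have := HN1 n (leq_maxl _ _); rewrite lt_min => /andP[nr ne].
have := HN2 n (leq_maxr _ _).
have := HL' u (w n); rewrite subrr normr0 [`|w n - u|]distrC => /(_ r'0 nr).
rewrite ler_norml => /andP[_ H].
have := Hw n; move: ne; rewrite ltr_pdivlMr ?(ltr_pwDl ltr01)//.
have : 0 <= `|u - w n| by [].
move: (n.+1%:R^-1 : R) => a; lra.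
Qed.

End SemiconvexFunctions.

(** * Bounded linear maps, dual functionals and the contraction principle *)

Section BoundedLinear.
Context {R : realType} {V : normedModType R}.

Lemma is_linear0 (W : normedModType R) (T : V -> W) : is_linear T -> T 0 = 0.
Proof.
by move=> linT; have := linT (-1) 0 0; rewrite scaler0 addr0 scaleN1r addNr.
Qed.

Lemma is_linearZ (W : normedModType R) (T : V -> W) a x :
  is_linear T -> T (a *: x) = a *: T x.
Proof.
by move=> linT; have := linT a x 0; rewrite (is_linear0 linT) !addr0.
Qed.

Lemma is_linearD (W : normedModType R) (T : V -> W) x y :
  is_linear T -> T (x + y) = T x + T y.
Proof. by move=> linT; have := linT 1 x y; rewrite !scale1r. Qed.

Lemma is_linearB (W : normedModType R) (T : V -> W) x y :
  is_linear T -> T (x - y) = T x - T y.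
Proof.
by move=> linT; rewrite is_linearD// -scaleN1r is_linearZ// scaleN1r.
Qed.

(** Continuity bounds the image of the unit ball, so that the [sup] in [opnorm] is a true upper
    bound; normalizing [v] then extends the estimate to the whole space. *)
Lemma opnorm_le (W : normedModType R) (T : V -> W) : is_linear T -> continuous T ->
  0 <= opnorm T /\ forall v, `|T v| <= opnorm T * `|v|.
Proof.
move=> linT contT.
pose f : {linear V -> W} := HB.pack T (GRing.isLinear.Build _ _ _ _ T linT).
have /linear_boundedP/pinfty_ex_gt0[r r0 Tr] : bounded_near f (nbhs 0).
  by apply/linear_bounded_continuous.
have ubT : has_ubound [set `|T v| | v in [set v : V | `|v| <= 1]].
  exists r => _ [v /= v1 <-]; apply: le_trans (Tr v) _.
  by rewrite ger_pMr.
split=> [|v].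
  apply: (@le_trans _ _ `|T 0|) => //; apply: ub_le_sup => //.
  by exists 0; rewrite //= normr0.
have [->|v0] := eqVneq v 0; first by rewrite is_linear0// !normr0 mulr0.
have nv : 0 < `|v| by rewrite normr_gt0.
rewrite -ler_pdivrMr// mulrC.
have -> : `|v|^-1 * `|T v| = `|T (`|v|^-1 *: v)|.
  by rewrite is_linearZ// normrZ normfV normr_id.
apply: ub_le_sup => //; exists (`|v|^-1 *: v) => //=.
by rewrite normrZ normfV normr_id mulVf// gt_eqF.
Qed.

Lemma dual_norm_le (xi : V -> R) : dual V xi ->
  0 <= dual_norm xi /\ forall v, `|xi v| <= dual_norm xi * `|v|.
Proof. by move=> [lin cont]; exact: opnorm_le. Qed.

Lemma dualP (xi : V -> R) (L : R) :
  (forall a x y, xi (a *: x + y) = a * xi x + xi y) ->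
  (forall v, `|xi v| <= L * `|v|) -> dual V xi.
Proof.
move=> lin bd; split; first exact: lin.
pose f : {linear V -> R^o} := HB.pack (xi : V -> R^o)
  (GRing.isLinear.Build _ _ _ _ (xi : V -> R^o) lin).
apply: (@bounded_linear_continuous _ _ _ f); apply/linear_boundedP.
exists L; split=> [|r Lr x]; first exact: num_real.
by apply: le_trans (bd x) _; rewrite ler_wpM2r// ltW.
Qed.

End BoundedLinear.

Lemma contraction_fixed_point (R : realType) (V : completeNormedModType R)
    (F : V -> V) (q : R) : 0 <= q -> q < 1 ->
  (forall x y, `|F x - F y| <= q * `|x - y|) -> exists u, F u = u.
Proof.
move=> q0 q1 Fq.
have ctr : @is_contraction R V V setT setT (totalfun F).
  exists (NngNum q0); split=> //= -[x y] _ /=; exact: Fq.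
have [||u _ uE] := banach_fixed_point ctr; [exact: closedT|by exists 0|].
by exists u.
Qed.

(** * The hemivariational inequality: stationarity, contraction, inclusion and bound *)

Section HemivariationalInequality.
Context {R : realType} {V X : completeNormedModType R}.
Context (gamma : V -> X) (A : V -> V -> R) (J : X -> X -> R).
Context (m_A m_alpha m_L M cg : R).
Context (gamma_lin : is_linear gamma) (cg_ge0 : 0 <= cg)
  (gamma_le : forall v, `|gamma v| <= cg * `|v|).
Context (A_dual : forall u, dual V (A u))
  (A_lin : forall a u w v, A (a *: u + w) v = a * A u v + A w v)
  (M_ge0 : 0 <= M) (A_le : forall u v, `|A u v| <= M * `|u| * `|v|)
  (A_sym : forall u v, A u v = A v u)
  (A_coercive : forall u, m_A * `|u| ^+ 2 <= A u u).
Context (J_lip : forall w, locally_lipschitz (J w))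
  (m_alpha_ge0 : 0 <= m_alpha) (m_L_ge0 : 0 <= m_L)
  (J_mono : forall w1 w2 v1 v2,
    clarke_dir (J w1) v1 (v2 - v1) + clarke_dir (J w2) v2 (v1 - v2) <=
    m_alpha * `|v1 - v2| ^+ 2 + m_L * `|w1 - w2| * `|v1 - v2|)
  (smallness : (m_alpha + m_L) * cg ^+ 2 < m_A).

Let AZr u a v : A u (a *: v) = a * A u v.
Proof. by have [lin _] := A_dual u; apply: is_linearZ lin. Qed.

Let ADr u v w : A u (v + w) = A u v + A u w.
Proof. by have [lin _] := A_dual u; apply: is_linearD lin. Qed.

Let ABr u v w : A u (v - w) = A u v - A u w.
Proof. by have [lin _] := A_dual u; apply: is_linearB lin. Qed.

Let ADl u v w : A (u + v) w = A u w + A v w.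
Proof. by rewrite !(A_sym _ w) ADr. Qed.

Let AZl u a v : A (a *: u) v = a * A u v.
Proof. by rewrite !(A_sym _ v) AZr. Qed.

Let ABl u v w : A (u - v) w = A u w - A v w.
Proof. by rewrite !(A_sym _ w) ABr. Qed.

Definition lagrangian (f : V -> R) (w v : V) : R :=
  1 / 2 * A v v - f v + J (gamma w) (gamma v).

Definition hvi (f : V -> R) (w u : V) :=
  forall v, 0 <= A u v - f v + clarke_dir (J (gamma w)) (gamma u) (gamma v).

Lemma norm_gamma_sqr_le v : `|gamma v| ^+ 2 <= cg ^+ 2 * `|v| ^+ 2.
Proof. by rewrite -exprMn lerXn2r// nnegrE ?mulr_ge0. Qed.

Lemma locally_lipschitz_lagrangian f w : dual V f ->
  locally_lipschitz (lagrangian f w).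
Proof.
move=> df; have [f0 fle] := dual_norm_le df; have [flin _] := df.
move=> u; have [r [L [r0 L0 HL]]] :=
  locally_lipschitz_ge0 (gamma u) (J_lip (gamma w)).
have cg1 : 0 < 1 + cg by rewrite ltr_pwDl.
exists (Num.min 1 (r / (1 + cg))); split; first by rewrite lt_min ltr01 divr_gt0.
exists (M * (`|u| + 1) + dual_norm f + L * cg) => y z.
rewrite !lt_min !ltr_pdivlMr// => /andP[yu yr] /andP[zu zr].
have gr x : `|x - u| * (1 + cg) < r -> `|gamma x - gamma u| < r.
  rewrite -is_linearB// => xr; apply: le_lt_trans (gamma_le _) _.
  by apply: le_lt_trans xr; rewrite mulrC ler_wpM2l// lerDr.
have nb x : `|x - u| < 1 -> `|x| <= `|u| + 1.
  by move=> xu; have := ler_normD u (x - u); rewrite addrC subrK; lra.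
have := HL _ _ (gr _ yr) (gr _ zr).
have := gamma_le (y - z); rewrite is_linearB// => /(ler_wpM2l L0) gyz Jyz.
have := fle (y - z); rewrite is_linearB// => fyz.
have : `|1 / 2 * A y y - 1 / 2 * A z z| <= M * (`|u| + 1) * `|y - z|.
  (* A difference of squares, by symmetry of [A]; the radius is at most 1, so the norm of [y + z] is
     at most 2 (|u| + 1). *)
  have -> : 1 / 2 * A y y - 1 / 2 * A z z = 1 / 2 * A (y + z) (y - z).
    by rewrite ABr !ADl (A_sym z y); lra.
  rewrite normrM ger0_norm ?divr_ge0//.
  have := A_le (y + z) (y - z).
  have : M * `|y + z| * `|y - z| <= M * (2 * (`|u| + 1)) * `|y - z|.
    rewrite ler_wpM2r// ler_wpM2l//; have := ler_normD y z.
    by have := nb _ yu; have := nb _ zu; lra.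
  lra.
move: fyz Jyz; rewrite /lagrangian !ler_norml => /andP[? ?] /andP[? ?] /andP[? ?].
apply/andP; split; lra.
Qed.

(** The parallelogram identity for [A] gains [A (x - y) (x - y) / 4], the linear term cancels, and
    [J] loses at most m_alpha / 4 times |gamma (x - y)|^2. *)
Lemma lagrangian_midpoint f w x y : dual V f ->
  2 * lagrangian f w (2^-1 *: (x + y)) +
    (m_A - m_alpha * cg ^+ 2) / 4 * `|x - y| ^+ 2 <=
  lagrangian f w x + lagrangian f w y.
Proof.
move=> [flin _]; have mono v1 v2 : clarke_dir (J (gamma w)) v1 (v2 - v1) +
    clarke_dir (J (gamma w)) v2 (v1 - v2) <= m_alpha * `|v1 - v2| ^+ 2.
  by have := J_mono (gamma w) (gamma w) v1 v2; rewrite subrr normr0 mulr0 mul0r addr0.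
have := clarke_monotone_midpoint (J_lip (gamma w)) m_alpha_ge0 mono (gamma x) (gamma y).
rewrite -is_linearD// -is_linearB// -is_linearZ//.
have := ler_wpM2l m_alpha_ge0 (norm_gamma_sqr_le (x - y)).
have := A_coercive (x - y).
rewrite /lagrangian AZr AZl ABr !ABl ADr !ADl (A_sym y x).
rewrite (is_linearZ _ _ (flin : is_linear (f : V -> R^o))).
rewrite (is_linearD _ _ (flin : is_linear (f : V -> R^o))).
rewrite -[_ *: (f x + f y)]/(2^-1 * (f x + f y)).
lra.
Qed.

(** Difference quotients of [J (gamma w)] composed with [gamma] are among those of [J (gamma w)]
    near [gamma u] in direction [gamma v], and the quadratic part has an explicit quotient. A
    negative right-hand side would thus keep all nearby quotients of the Lagrangian negative. *)
Lemma clarke_dd_lagrangian_hvi f w u : dual V f ->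
  (forall v, (0%:E <= clarke_dd (lagrangian f w) u v)%E) -> hvi f w u.
Proof.
move=> [flin _] stat v; rewrite leNgt; apply/negP.
set D := clarke_dir _ _ _ => s0.
(* One [e] is spent on the quotient of [J], one on the error [C * d] of the quadratic part, and
   [- e] remains. *)
have [e e0 eE] : exists2 e, 0 < e & A u v - f v + D = - (3 * e).
  by exists (- (A u v - f v + D) / 3); [rewrite divr_gt0// oppr_gt0|field].
have [|d1 d10 H] := @clarke_dir_lt _ _ (J (gamma w)) (gamma u) (gamma v) (D + e)
  (J_lip _); first by rewrite ltrDl.
pose C := M * `|v| + M * `|v| ^+ 2.
have C0 : 0 <= C by rewrite addr_ge0 ?mulr_ge0 ?exprn_ge0.
have C1 : 0 < 1 + C by rewrite ltr_pwDl.
have cg1 : 0 < 1 + cg by rewrite ltr_pwDl.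
pose d := Num.min (d1 / (1 + cg)) (e / (1 + C)).
have d0 : 0 < d by rewrite lt_min !divr_gt0.
have dd1 : d * (1 + cg) <= d1 by rewrite -ler_pdivlMr// ge_min lexx.
have de : d * (1 + C) <= e by rewrite -ler_pdivlMr// ge_min lexx orbT.
suff : (clarke_dd (lagrangian f w) u v <= (- e)%:E)%E.
  by move=> /(le_trans (stat v)); rewrite lee_fin; lra.
apply: (clarke_dd_le d0) => y l yu l0 ld.
have gyu : `|gamma y - gamma u| < d1.
  rewrite -is_linearB//; apply: le_lt_trans (gamma_le _) _; apply: lt_le_trans dd1.
  have := ler_wpM2r cg_ge0 (ltW yu); lra.
have ld1 : l < d1.
  by apply: lt_le_trans ld _; apply: le_trans dd1; rewrite ler_peMr ?lerDl ?(ltW d0).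
have := H _ _ gyu l0 ld1.
rewrite -is_linearZ// -is_linearD// => HJ.
have -> : (lagrangian f w (y + l *: v) - lagrangian f w y) / l =
    A y v + l / 2 * A v v - f v +
    (J (gamma w) (gamma (y + l *: v)) - J (gamma w) (gamma y)) / l.
  rewrite /lagrangian ADr !ADl AZl !AZr AZl (A_sym v y) addrC.
  rewrite (is_linearD _ _ (flin : is_linear (f : V -> R^o))).
  rewrite (is_linearZ _ _ (flin : is_linear (f : V -> R^o))).
  by rewrite -[_ *: f v]/(l * f v); field; rewrite gt_eqF.
have Ay : A y v - A u v <= M * `|v| * d.
  rewrite -ABl; apply: le_trans (ler_norm _) _; apply: le_trans (A_le _ _) _.
  by rewrite mulrAC ler_wpM2l ?mulr_ge0// ltW.
have Av : l / 2 * A v v <= M * `|v| ^+ 2 * d.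
  have : l * A v v <= l * (M * `|v| ^+ 2).
    rewrite ler_wpM2l ?(ltW l0)//; apply: le_trans (ler_norm _) _.
    by apply: le_trans (A_le _ _) _; rewrite expr2 mulrA.
  have : l * (M * `|v| ^+ 2) <= d * (M * `|v| ^+ 2).
    by rewrite ler_wpM2r ?(ltW ld)// mulr_ge0 ?exprn_ge0.
  have : 0 <= d * (M * `|v| ^+ 2) by rewrite !mulr_ge0 ?exprn_ge0// ltW.
  lra.
move: de; rewrite /C => de.
lra.
Qed.

(** Testing each inequality with the difference of the solutions and adding cancels [f]; coercivity
    and [J_mono] then bound |u1 - u2|^2, and one factor |u1 - u2| is divided out. *)
Lemma hvi_contraction f w1 w2 u1 u2 : dual V f -> hvi f w1 u1 -> hvi f w2 u2 ->
  (m_A - m_alpha * cg ^+ 2) * `|u1 - u2| <= m_L * cg ^+ 2 * `|w1 - w2|.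
Proof.
move=> [flin _] /(_ (u2 - u1)) H1 /(_ (u1 - u2)) H2.
have [->|u12] := eqVneq u1 u2.
  by rewrite subrr normr0 mulr0 !mulr_ge0 ?exprn_ge0.
have nu : 0 < `|u1 - u2| by rewrite normr_gt0 subr_eq0.
have := J_mono (gamma w1) (gamma w2) (gamma u1) (gamma u2).
move: H1 H2; rewrite -!is_linearB//.
rewrite !(is_linearB _ _ (flin : is_linear (f : V -> R^o))).
have := A_coercive (u1 - u2); rewrite !ABr !ABl => HA H1 H2 HJ.
have Hw : `|gamma (w1 - w2)| * `|gamma (u1 - u2)| <=
    cg ^+ 2 * (`|w1 - w2| * `|u1 - u2|).
  by rewrite expr2 mulrACA ler_pM.
have := ler_wpM2l m_L_ge0 Hw.
have := ler_wpM2l m_alpha_ge0 (norm_gamma_sqr_le (u1 - u2)) => Ha HL.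
rewrite -(ler_pM2r nu); lra.
Qed.

Let k_gt0 : 0 < m_A - m_alpha * cg ^+ 2.
Proof.
have : 0 <= m_L * cg ^+ 2 by rewrite mulr_ge0 ?exprn_ge0.
by move: smallness; lra.
Qed.

Lemma hvi_unique f u1 u2 : dual V f -> hvi f u1 u1 -> hvi f u2 u2 -> u1 = u2.
Proof.
move=> df H1 H2; have := hvi_contraction df H1 H2; rewrite -subr_ge0 -mulrBl => H.
apply/eqP; rewrite -subr_eq0 -normr_eq0 eq_le normr_ge0 andbT.
rewrite -(@nmulr_rge0 _ (m_L * cg ^+ 2 - (m_A - m_alpha * cg ^+ 2)))//.
by move: smallness; lra.
Qed.

Lemma lagrangian_stationary_exists f : dual V f ->
  exists u, forall v, (0%:E <= clarke_dd (lagrangian f u) u v)%E.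
Proof.
move=> df.
have /choice[F FP] w : exists u, forall v, (0%:E <= clarke_dd (lagrangian f w) u v)%E.
  have k4 : 0 < (m_A - m_alpha * cg ^+ 2) / 4 by rewrite divr_gt0.
  have [u umin] := midpoint_convex_minimizer k4
    (locally_lipschitz_lagrangian w df) (fun x y => lagrangian_midpoint w x y df).
  (* At the minimizer itself as base point, every quotient is nonnegative. *)
  exists u => v; apply: clarke_dd_ge => d d0; exists u, (d / 2).
  have l0 : 0 < d / 2 by rewrite divr_gt0.
  rewrite subrr normr0 ltr_pdivrMr// ltr_pMr// ltr1n; split=> //.
  by rewrite divr_ge0 ?(ltW l0)// subr_ge0.
(* The ratio is the one given by [hvi_contraction]; [smallness] says exactly that it is below 1. *)
have [||x y|u Fu] := @contraction_fixed_point _ _ F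
    (m_L * cg ^+ 2 / (m_A - m_alpha * cg ^+ 2)).
- by rewrite divr_ge0 ?(ltW k_gt0)// mulr_ge0 ?exprn_ge0.
- by rewrite ltr_pdivrMr// mul1r; move: smallness; lra.
- rewrite mulrAC ler_pdivlMr// mulrC; apply: (@hvi_contraction f) => //.
    exact: clarke_dd_lagrangian_hvi.
  exact: clarke_dd_lagrangian_hvi.
by exists u => v; rewrite -{2}Fu.
Qed.

(** For the converse, [xi] is prescribed on the range of [gamma], where [gamma] may fail to be
    injective. Instead of a functional on that range, the cone of pairs [(gamma v, f v - A u v)] is
    used: [hvi] says that it lies below [p], a linear functional under the resulting [q] satisfies
    one inequality, and replacing [v] by [- v] gives the other. *)
Lemma inclusion_hvi f u : dual V f ->
  (exists xi, clarke_subdiff (J (gamma u)) (gamma u) xi /\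
    forall v, A u v + xi (gamma v) = f v) <-> hvi f u u.
Proof.
move=> [flin fcont]; split=> [[xi [[_ xile] Exi]] v|Hu].
  have := xile (gamma v); rewrite clarke_dirE// lee_fin -Exi; lra.
set p := clarke_dir (J (gamma u)) (gamma u).
have sp : sublinear p by apply: sublinear_clarke_dir.
have fZ a v : f (a *: v) = a * f v := is_linearZ a v flin.
have fD v w : f (v + w) = f v + f w := is_linearD v w flin.
pose K := [set (gamma v, f v - A u v) | v in [set: V]].
have [|||_ [v _ <-]/=|q [sq qp qK]] := @sublinear_inf_cone _ _ p K sp.
- exists 0 => //; rewrite is_linear0// (is_linear0 flin).
  by rewrite -(scale0r (0 : V)) AZr mul0r subr0.
- move=> _ _ [v _ <-] [w _ <-]; exists (v + w) => //=.
  by rewrite (is_linearD _ _ gamma_lin) fD ADr; congr (_, _); lra.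
- move=> t _ t0 [v _ <-]; exists (t *: v) => //=.
  by rewrite (is_linearZ _ _ gamma_lin) fZ AZr mulrBr.
- by have := Hu v; rewrite -/p; lra.
have [xi [xilin xiq]] := hahn_banach_sublinear sq.
have xiN x : xi (- x) = - xi x.
  by rewrite -scaleN1r (is_linearZ _ _ (xilin : is_linear (xi : X -> R^o))) scaleN1r.
have [L L0 pL] := clarke_dir_bound (gamma u) (J_lip (gamma u)).
have xip x : xi x <= p x by apply: le_trans (xiq _) (qp _).
exists xi; split; first split.
- apply: (@dualP _ _ _ L) => // x; rewrite ler_norml.
  have := xip x; have := xip (- x); have := pL x; have := pL (- x).
  rewrite xiN normrN -/p !ler_norml => /andP[_ ?] /andP[_ ?] ? ?; apply/andP; split; lra.
- by move=> x; rewrite clarke_dirE// lee_fin.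
have ge v : f v - A u v <= xi (gamma v).
  have := qK _ (ex_intro2 _ _ v I erefl); have := xiq (- gamma v).
  by rewrite xiN /=; lra.
move=> v; have := ge v; have := ge (- v).
rewrite -scaleN1r fZ AZr (is_linearZ _ _ gamma_lin) scaleN1r xiN; lra.
Qed.

(** Testing with [- u] and comparing with the origin in [J_mono] bounds k |u| by
    [dual_norm f + L * cg]. Here [L] bounds the Clarke derivative of [J 0] at 0, so [c] depends
    neither on [f] nor on [u]. *)
Lemma hvi_bound : exists2 c, 0 < c & forall f u, dual V f -> hvi f u u ->
  `|u| <= c * (1 + dual_norm f).
Proof.
have [L L0 JL] := clarke_dir_bound 0 (J_lip 0).
pose k := m_A - (m_alpha + m_L) * cg ^+ 2.
have k0 : 0 < k by rewrite subr_gt0.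
have LC : 0 <= L * cg by rewrite mulr_ge0.
exists ((1 + L * cg) / k) => [|f u df Hu]; first by rewrite divr_gt0// ltr_pwDl.
have [f0 fle] := dual_norm_le df.
rewrite mulrAC ler_pdivlMr// mulrC.
have [->|un0] := eqVneq u 0.
  by rewrite normr0 mulr0 mulr_ge0// addr_ge0.
have nu : 0 < `|u| by rewrite normr_gt0.
have := Hu (- u); rewrite -scaleN1r.
have [flin _] := df; have fZ a v : f (a *: v) = a * f v := is_linearZ a v flin.
rewrite fZ AZr (is_linearZ _ _ gamma_lin) scaleN1r.
have := J_mono (gamma u) 0 (gamma u) 0; rewrite !subr0 sub0r.
have := JL (gamma u); rewrite ler_norml => /andP[HL _].
have := ler_wpM2l L0 (gamma_le u) => HLg HJ Hu'.
have Hg : (m_alpha + m_L) * `|gamma u| ^+ 2 <= (m_alpha + m_L) * (cg ^+ 2 * `|u| ^+ 2).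
  by rewrite ler_wpM2l ?addr_ge0// norm_gamma_sqr_le.
have HA := A_coercive u.
have := fle u; rewrite ler_norml => /andP[_ Hf].
have Hp : 0 <= dual_norm f * (L * cg * `|u|) by rewrite !mulr_ge0.
rewrite -(ler_pM2r nu) /k; lra.
Qed.

End HemivariationalInequality.

Theorem theorem1 (R : realType) (V X : completeNormedModType R)
  (gamma : V -> X) (A : V -> V -> R) (J : X -> X -> R)
  (m_A c0 c1 c2 m_alpha m_L : R) :
  reflexive_space V ->
  (* gamma in L(V,X) *)
  is_linear gamma -> continuous gamma ->
  (* (A1) A : V -> V^* linear and bounded *)
  (forall u : V, dual V (A u)) ->
  (forall (a : R) (u w v : V), A (a *: u + w) v = a * A u v + A w v) ->
  (exists M : R, forall u : V, dual_norm (A u) <= M * `|u|) ->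
  (* (A2) symmetry *)
  (forall u v : V, A u v = A v u) ->
  (* (A3) coercivity *)
  0 < m_A -> (forall u : V, m_A * `|u| ^+ 2 <= A u u) ->
  (* (J1) *)
  (forall w : X, locally_lipschitz (J w)) ->
  (* (J2) *)
  0 <= c0 -> 0 <= c1 -> 0 <= c2 ->
  (forall (w v : X) (xi : X -> R), clarke_subdiff (J w) v xi ->
      dual_norm xi <= c0 + c1 * `|v| + c2 * `|w|) ->
  (* (J3) *)
  0 <= m_alpha -> 0 <= m_L ->
  (forall w1 w2 v1 v2 : X,
      (clarke_dd (J w1) v1 (v2 - v1)%R + clarke_dd (J w2) v2 (v1 - v2)%R
        <= (m_alpha * `|v1 - v2| ^+ 2 + m_L * `|w1 - w2| * `|v1 - v2|)%:E)%E) ->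
  (* (S) *)
  (m_alpha + m_L) * opnorm gamma ^+ 2 < m_A ->
  exists c : R, 0 < c /\
  forall f : V -> R, dual V f ->
    let Lag := fun w v : V => 1 / 2 * A v v - f v + J (gamma w) (gamma v) in
    let probI := fun u : V => exists xi : X -> R,
          clarke_subdiff (J (gamma u)) (gamma u) xi /\
          forall v : V, A u v + xi (gamma v) = f v in
    let probO := fun u : V => clarke_subdiff (Lag u) u (fun _ => 0) in
    (forall u : V, probI u <-> probO u) /\
    (exists! u : V, probI u) /\
    (forall u : V, probI u -> `|u| <= c * (1 + dual_norm f)).
Proof.
move=> _ gamma_lin gamma_cont A_dual A_lin [M A_bd] A_sym _ A_coercive J_lip
  _ _ _ _ m_alpha_ge0 m_L_ge0 J_mono smallness.
have [cg_ge0 gamma_le] := opnorm_le gamma_lin gamma_cont.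
(* The absolute value is taken because the given bound [M] carries no sign. *)
have A_le u v : `|A u v| <= `|M| * `|u| * `|v|.
  have [_ Aule] := dual_norm_le (A_dual u); apply: le_trans (Aule v) _.
  rewrite ler_wpM2r//; apply: le_trans (A_bd u) _.
  by rewrite ler_wpM2r// ler_norm.
have J_mono' w1 w2 v1 v2 :
    clarke_dir (J w1) v1 (v2 - v1) + clarke_dir (J w2) v2 (v1 - v2) <=
    m_alpha * `|v1 - v2| ^+ 2 + m_L * `|w1 - w2| * `|v1 - v2|.
  by have := J_mono w1 w2 v1 v2; rewrite !clarke_dirE// -EFinD lee_fin.
have [c c_gt0 bound] := hvi_bound gamma_lin cg_ge0 gamma_le A_dual A_coercive J_lip
  m_alpha_ge0 m_L_ge0 J_mono' smallness.
exists c; split=> // f df Lag probI probO.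
have IE u : probI u <-> hvi gamma A J f u u.
  exact: (inclusion_hvi gamma_lin A_dual J_lip _ df).
have OI u : probO u -> probI u.
  move=> [_ stat]; apply/IE.
  exact: (clarke_dd_lagrangian_hvi gamma_lin cg_ge0 gamma_le A_dual (normr_ge0 M)
    A_le A_sym J_lip df stat).
have Iuniq u1 u2 : probI u1 -> probI u2 -> u1 = u2.
  move=> /IE H1 /IE H2.
  exact: (hvi_unique gamma_lin cg_ge0 gamma_le A_dual A_sym A_coercive
    m_alpha_ge0 m_L_ge0 J_mono' smallness df H1 H2).
have [u0 u0P] := lagrangian_stationary_exists gamma_lin cg_ge0 gamma_le A_dual
  (normr_ge0 M) A_le A_sym A_coercive J_lip m_alpha_ge0 m_L_ge0 J_mono' smallness df.
have Ou0 : probO u0.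
  split=> //; apply: (@dualP _ _ _ 0) => [a x y|v]; last by rewrite normr0 mul0r.
  by rewrite mulr0 addr0.
split; last split.
(* A solution of (I) coincides with [u0], which solves (O) and hence (I), because (I) has at most
   one solution. *)
- move=> u; split; last exact: OI.
  by move=> /(Iuniq _ _ (OI _ Ou0)) <-.
- by exists u0; split; [exact: OI|move=> u; apply: Iuniq; exact: OI].
- by move=> u /IE; exact: bound.
Qed.
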